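(* Let $1\le r<k$ and let $\mathcal{G}$ be a digraph with vertices $v_1,\dots,v_k$ that contains a loop, such that from each $v_i$ with $i>r$ there is a path to some $v_j$ with $j\le r$, and from each $v_i$ with $i\le r$ there is a path to some $v_j$ with $j>r$. Let $\mathcal{G}_s,\mathcal{G}_u$ be the subgraphs of $\mathcal{G}$ with $\mathcal{E}(\mathcal{G}_s)=\{(i,j)\in\mathcal{E}(\mathcal{G}): i\le r\}$ and $\mathcal{E}(\mathcal{G}_u)=\{(i,j)\in\mathcal{E}(\mathcal{G}): i>r\}$. Let $A_1,\dots,A_k$ be real $d\times d$ matrices, diagonalizable over $\mathbb{C}$, with $A_1,\dots,A_r$ stable and $A_{r+1},\dots,A_k$ unstable. Let $-\lambda_i<0$ ($1\le i\le r$) and $\mu_j>0$ ($r+1\le j\le k$) be the maximum of the real parts of the eigenvalues of $A_i$ and $A_j$, respectively. Suppose that $\mathcal{G}_u$ is acyclic, and let $Q_1,\dots,Q_k$ be eigenvector matrices of $A_1,\dots,A_k$ chosen so that $\max\{\Vert Q_b^{-1}Q_a\Vert:(a,b)\in\mathcal{E}(\mathcal{G}_u)\}<1$ (such a choice exists because $\mathcal{G}_u$ is acyclic). Let $\tau,\eta>0$ and let $\sigma$ be a $\mathcal{G}$-admissible signal with infinitely many switching times $t_1<t_2<\cdots$, $t_n\to\infty$, such that for every $T>0$ there exist $t,s>T$ with $\sigma(t)\in\{1,\dots,r\}$ and $\sigma(s)\in\{r+1,\dots,k\}$. Assume $\sigma\in\mathcal{S}_{\mathcal{G}}(\tau,\eta)$,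 i.e. for all $n\ge0$ (with $t_0=0$), $t_{n+1}-t_n\ge\tau$ if $\sigma(t_n)\in\{1,\dots,r\}$ and $t_{n+1}-t_n\le\eta$ if $\sigma(t_n)\in\{r+1,\dots,k\}$. If $$\tau>\max_{(i,j)\in\mathcal{E}(\mathcal{G}_s)}\frac{\ln\Vert Q_j^{-1}Q_i\Vert}{\lambda_i}\qquad\text{and}\qquad \eta<-\max_{(i,j)\in\mathcal{E}(\mathcal{G}_u)}\frac{\ln\Vert Q_j^{-1}Q_i\Vert}{\mu_i},$$ then the switched system $x'(t)=A_{\sigma(t)}x(t)$, $t\ge0$, is asymptotically stable, i.e. $\lim_{t\to\infty}\Vert x(t)\Vert=0$ for every $x(0)\in\mathbb{R}^d$.
   Context: A matrix is stable if all its eigenvalues have negative real part, and unstable if it has at least one eigenvalue with positive real part and no eigenvalue with zero real part. $\mathcal{E}(\cdot)$ denotes the edge set, as a set of pairs $(i,j)$ such that there is a directed edge from $v_i$ to $v_j$ (at most one edge from any vertex to another). A loop is a closed directed path; a digraph is acyclic if it contains no loop. A $\mathcal{G}$-admissible signal is a right-continuous piecewise constant function $\sigma:[0,\infty)\to\{1,\dots,k\}$ with switching times (discontinuities) $t_1<t_2<\cdots$ and $t_0=0$, such that, writing $\sigma_n$ for the value of $\sigma$ on $[t_{n-1},t_n)$, one has $(\sigma_n,\sigma_{n+1})\in\mathcal{E}(\mathcal{G})$ for all $n\ge1$. An eigenvector matrix of $A_j$ is an invertible real matrix $Q_j$ with $A_j=Q_jD_jQ_j^{-1}$, where $D_j$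 is the real Jordan form of $A_j$; its columns are eigenvectors of $A_j$ (real and imaginary parts of complex eigenvectors for non-real conjugate pairs of eigenvalues), not necessarily of unit norm. $\Vert\cdot\Vert$ is the Euclidean norm of vectors and the spectral norm of matrices. *)

(* Defs.v *)
From HB Require Import structures.
From mathcomp Require Import all_boot all_order all_algebra.
From mathcomp Require Import all_classical all_reals all_analysis.
From mathcomp Require Import complex.

Set Implicit Arguments.
Unset Strict Implicit.
Unset Printing Implicit Defensive.

Import Order.TTheory GRing.Theory Num.Theory.
Import numFieldNormedType.Exports.

Local Open Scope classical_set_scope.
Local Open Scope ring_scope.

Definition enorm (R : realType) (d : nat) (x : 'cV[R]_d) : R :=
  Num.sqrt (\sum_(i < d) x i ord0 ^+ 2).

(* The spectral norm, as the operator norm induced by [enorm]. The library's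
   own norm on matrices is the entrywise maximum. *)
Definition snorm (R : realType) (d : nat) (A : 'M[R]_d) : R :=
  sup [set enorm (A *m x) | x in [set x : 'cV[R]_d | enorm x <= 1]].

Definition complexify (R : realType) (d : nat) (A : 'M[R]_d) : 'M[R[i]]_d :=
  map_mx (real_complex R) A.

Definition stable (R : realType) (d : nat) (A : 'M[R]_d) : Prop :=
  forall z : R[i], eigenvalue (complexify A) z -> complex.Re z < 0.

Definition unstable (R : realType) (d : nat) (A : 'M[R]_d) : Prop :=
  (exists2 z : R[i], eigenvalue (complexify A) z & 0 < complex.Re z) /\
  (forall z : R[i], eigenvalue (complexify A) z -> complex.Re z <> 0).

Definition max_real_part (R : realType) (d : nat) (A : 'M[R]_d) (m : R) : Prop :=
  (exists2 z : R[i], eigenvalue (complexify A) z & complex.Re z = m) /\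
  (forall z : R[i], eigenvalue (complexify A) z -> complex.Re z <= m).

(* The blocks occurring in the real Jordan form of a matrix that is
   diagonalizable over C: a 1 x 1 block for a real eigenvalue, and the block
   [[a, b], [-b, a]] for a pair a +- ib of non-real eigenvalues. Either sign of b
   and, below, any order of the blocks is allowed. *)
Definition real_jordan_block (R : realType) (p : nat) (B : 'M[R]_p) : Prop :=
  p = 1%N \/
  p = 2%N /\ exists a b : R, b != 0 /\
    B = \matrix_(i, j) (if i == j then a else if (i < j)%N then b else - b).

Definition real_jordan_form (R : realType) (d : nat) (D : 'M[R]_d) : Prop :=
  exists (n : nat) (p : 'I_n -> nat) (B : forall i, 'M[R]_(p i))
         (eq_d : (\sum_i p i)%N = d),
    (forall i, real_jordan_block (B i)) /\
    D = castmx (eq_d, eq_d) (mxdiag B).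

Definition eigenvector_matrix (R : realType) (d : nat) (A Q : 'M[R]_d) : Prop :=
  Q \in unitmx /\
  exists2 D : 'M[R]_d, real_jordan_form D & A = Q *m D *m invmx Q.

(* A digraph on k vertices is its edge relation; the vertices v_1, ..., v_k
   are numbered from 0, so that v_1, ..., v_r are the i : 'I_k with [i < r]. *)
Definition has_loop (k : nat) (E : rel 'I_k) : Prop :=
  exists2 c : seq 'I_k, c != [::] & cycle E c.

Definition Gs (k r : nat) (E : rel 'I_k) : rel 'I_k :=
  fun i j => E i j && (i < r)%N.

Definition Gu (k r : nat) (E : rel 'I_k) : rel 'I_k :=
  fun i j => E i j && (r <= i)%N.

(* The maximum of f over the edges, with value -oo if there is no edge. *)
Definition edge_max (R : realType) (k : nat) (E : rel 'I_k)
    (f : 'I_k -> 'I_k -> R) : \bar R :=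
  (\big[maxe/-oo]_(e : 'I_k * 'I_k | E e.1 e.2) (f e.1 e.2)%:E)%E.

(* [sigma] (of which only the values on [0, +oo[ matter) is a right-continuous
   piecewise constant function with infinitely many switching times
   t 1 < t 2 < ... tending to infinity. *)
Definition switching_signal (R : realType) (k : nat)
    (sigma : R -> 'I_k) (t : nat -> R) : Prop :=
  [/\ t 0%N = 0,
      forall n, t n < t n.+1,
      t n @[n --> \oo] --> +oo,
      forall n s, t n <= s < t n.+1 -> sigma s = sigma (t n) &
      forall n, sigma (t n.+1) <> sigma (t n)].

Definition admissible (R : realType) (k : nat) (E : rel 'I_k)
    (sigma : R -> 'I_k) (t : nat -> R) : Prop :=
  forall n, E (sigma (t n)) (sigma (t n.+1)).

Definition dwell_flee (R : realType) (k r : nat) (sigma : R -> 'I_k)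
    (t : nat -> R) (tau eta : R) : Prop :=
  forall n, ((sigma (t n) < r)%N -> tau <= t n.+1 - t n) /\
            ((r <= sigma (t n))%N -> t n.+1 - t n <= eta).

(* Solutions are continuous on [0, +oo[ and satisfy the equation away from the
   switching times, where they are in general not differentiable. *)
Definition solution (R : realType) (d k : nat) (A : 'I_k -> 'M[R]_d)
    (sigma : R -> 'I_k) (t : nat -> R) (x : R -> 'cV[R]_d) : Prop :=
  {within `[0, +oo[, continuous x} /\
  forall n s, t n < s < t n.+1 -> is_derive s (1 : R) x (A (sigma s) *m x s).

Definition asymptotically_stable (R : realType) (d k : nat)
    (A : 'I_k -> 'M[R]_d) (sigma : R -> 'I_k) (t : nat -> R) : Prop :=
  forall (x0 : 'cV[R]_d) (x : R -> 'cV[R]_d),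
    solution A sigma t x -> x 0 = x0 ->
    enorm (x s) @[s --> +oo] --> (0 : R).

(* Main.v *)
Require Import Defs.
From HB Require Import structures.
From mathcomp Require Import all_boot all_order all_algebra.
From mathcomp Require Import all_classical all_reals all_analysis.
From mathcomp Require Import complex.
From mathcomp Require Import ring.

Set Implicit Arguments.
Unset Strict Implicit.
Unset Printing Implicit Defensive.

Import Order.TTheory GRing.Theory Num.Theory.
Import numFieldNormedType.Exports.

Local Open Scope classical_set_scope.
Local Open Scope ring_scope.

(** In the coordinates [y = Q_i^-1 x] the active mode is [y' = D_i y] with [D_i]
    a real Jordan form, whose symmetric part is diagonal with entries the real
    parts of the eigenvalues. Hence [exp (- m_i s) |y s|] is nonincreasing, [m_i]
    being the maximal real part. At a switch from [i] to [j] the coordinates are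
    multiplied by [Q_j^-1 Q_i], so [|Q^-1 x|] sampled at the switching times is
    multiplied by at most [|Q_j^-1 Q_i| exp (m_i dt)] per step, which the bounds on
    [tau] and [eta] make less than 1, uniformly over the finitely many edges.
    Between switching times the growth factor is bounded by [exp (mu_i eta)]. *)

(** * Euclidean and spectral norms *)

Lemma enorm_ge0 (R : realType) (d : nat) (x : 'cV[R]_d) : 0 <= enorm x.
Proof. exact: sqrtr_ge0. Qed.

Lemma enorm0 (R : realType) (d : nat) : enorm (0 : 'cV[R]_d) = 0.
Proof. by rewrite /enorm big1 ?sqrtr0// => i _; rewrite mxE expr0n. Qed.

Lemma sqr_enorm (R : realType) (d : nat) (x : 'cV[R]_d) :
  enorm x ^+ 2 = \sum_(i < d) x i ord0 ^+ 2.
Proof. by rewrite sqr_sqrtr// sumr_ge0// => i _; exact: sqr_ge0. Qed.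

Lemma sqr_enorm_dot (R : realType) (d : nat) (x : 'cV[R]_d) :
  enorm x ^+ 2 = (x^T *m x) ord0 ord0.
Proof. by rewrite sqr_enorm mxE; apply: eq_bigr => i _; rewrite mxE expr2. Qed.

Lemma enormZ (R : realType) (d : nat) (a : R) (x : 'cV[R]_d) :
  enorm (a *: x) = `|a| * enorm x.
Proof.
rewrite /enorm -sqrtr_sqr -sqrtrM ?sqr_ge0// mulr_sumr.
by congr Num.sqrt; apply: eq_bigr => i _; rewrite mxE exprMn.
Qed.

Lemma le_coord_enorm (R : realType) (d : nat) (x : 'cV[R]_d) (i : 'I_d) :
  `|x i ord0| <= enorm x.
Proof.
rewrite -sqrtr_sqr ler_sqrt ?sumr_ge0// => [|j _]; last exact: sqr_ge0.
by rewrite (bigD1 i)//= lerDl sumr_ge0// => j _; exact: sqr_ge0.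
Qed.

Lemma enorm_eq0 (R : realType) (d : nat) (x : 'cV[R]_d) : enorm x = 0 -> x = 0.
Proof.
move=> x0; apply/colP => i; rewrite mxE; apply/eqP.
by rewrite -normr_le0 -x0 le_coord_enorm.
Qed.

(** The coordinates of a vector of the unit ball are at most 1 in absolute value, so those of
    [A *m x] are bounded by the absolute row sums of [A]. This makes the [sup] in [snorm] a genuine
    supremum rather than a default value. *)
Lemma snorm_has_ubound (R : realType) (d : nat) (A : 'M[R]_d) :
  has_ubound [set enorm (A *m x) | x in [set x : 'cV[R]_d | enorm x <= 1]].
Proof.
exists (Num.sqrt (\sum_(i < d) (\sum_(j < d) `|A i j|) ^+ 2)) => _ [x /= x1 <-].
rewrite ler_sqrt; last by apply: sumr_ge0 => i _; exact: sqr_ge0.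
apply: ler_sum => i _; rewrite -real_normK ?num_real// lerXn2r ?nnegrE//.
  by apply: sumr_ge0 => j _.
rewrite mxE; apply: le_trans (ler_norm_sum _ _ _) _.
apply: ler_sum => j _; rewrite normrM ler_piMr//.
exact: le_trans (le_coord_enorm x j) x1.
Qed.

Lemma enorm_mulmx_le (R : realType) (d : nat) (A : 'M[R]_d) (x : 'cV[R]_d) :
  enorm (A *m x) <= snorm A * enorm x.
Proof.
have [x0|xN0] := eqVneq (enorm x) 0.
  by rewrite (enorm_eq0 x0) mulmx0 enorm0 mulr0.
have xgt0 : 0 < enorm x by rewrite lt_neqAle eq_sym xN0 enorm_ge0.
rewrite -ler_pdivrMr// mulrC -[X in X * _]ger0_norm ?invr_ge0 ?enorm_ge0//.
rewrite -enormZ scalemxAr; apply: (ub_le_sup (snorm_has_ubound A)).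
exists ((enorm x)^-1 *: x) => //=.
by rewrite enormZ ger0_norm ?invr_ge0 ?enorm_ge0// mulVf.
Qed.

Lemma snorm_ge0 (R : realType) (d : nat) (A : 'M[R]_d) : 0 <= snorm A.
Proof.
apply: (ub_le_sup (snorm_has_ubound A)); exists 0; rewrite /= ?enorm0//.
by rewrite mulmx0 enorm0.
Qed.

(** * Quadratic forms of real Jordan forms *)

Lemma real_jordan_block_eigen (R : realType) (p : nat) (B : 'M[R]_p) :
  real_jordan_block B -> exists (z : R[i]) (u : 'rV[R[i]]_p),
    [/\ u != 0, u *m complexify B = z *: u &
     forall x : 'cV[R]_p,
       (x^T *m B *m x) ord0 ord0 = complex.Re z * enorm x ^+ 2].
Proof.
case=> [p1|[p2 [a [b [b0 defB]]]]].
  subst p; exists ((B ord0 ord0)%:C)%C, (const_mx 1); split.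
  - by apply/eqP => /rowP /(_ ord0); rewrite !mxE => /eqP; rewrite oner_eq0.
  - by apply/rowP => j; rewrite !mxE big_ord1 !mxE mul1r mulr1 !ord1.
  - move=> x; rewrite sqr_enorm big_ord1 !mxE !big_ord1 !mxE !big_ord1 !mxE /=.
    by ring.
(* [eigenvalue] is about row vectors: the row (1, i) is a left eigenvector for a - ib. In the
   quadratic form the skew entries b and -b cancel, which leaves a times the squared norm. *)
subst p; exists (a -i* b)%C, (\row_j (if j == ord0 then 1 else 'i)%C); split.
- by apply/eqP => /rowP /(_ ord0); rewrite !mxE => /eqP; rewrite oner_eq0.
- apply/rowP => j; rewrite !mxE !big_ord_recr big_ord0 /= defB !mxE.
  by case: j => -[|[|//]] ?; apply/eqP; rewrite eq_complex /=;
     apply/andP; split; apply/eqP; ring.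
- move=> x; rewrite sqr_enorm !mxE !big_ord_recr !big_ord0 /= !mxE.
  rewrite !big_ord_recr !big_ord0 /= defB !mxE /=.
  by ring.
Qed.

Lemma eigenvalue_mxdiag (F : fieldType) (n : nat) (p : 'I_n -> nat)
    (B : forall i, 'M[F]_(p i)) (i : 'I_n) (u : 'rV[F]_(p i)) (z : F) :
  u != 0 -> u *m B i = z *: u -> eigenvalue (mxdiag B) z.
Proof.
(* [u *m P] is [u] padded with zeros outside the [i]-th block. *)
move=> u0 uB; set P := submxcol (1%:M : 'M[F]_(\sum_i p i)) i.
have PB : P *m mxdiag B = B i *m P.
  rewrite /P submxcol_mul mul1mx -[X in submxcol X i]mulmx1.
  by rewrite -{1}(submxcolK 1%:M) mul_mxdiag_mxcol mxcolK.
apply/eigenvalueP; exists (u *m P); first by rewrite -mulmxA PB mulmxA uB scalemxAl.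
apply: contra u0 => /eqP uP0.
(* The [i]-th column block of [P] is the identity, so [u] can be read off from [u *m P]. *)
have P1 : submxrow P i = 1%:M.
  by rewrite /P -submxblockEv -mxdiagZ submxblock_diag.
by rewrite -[u]mulmx1 -P1 mul_submxrow uP0 submxrow0.
Qed.

(** The quadratic form splits over the diagonal blocks. Each block contributes Re z times the
    squared norm of its part of [y], where z is an eigenvalue of the block and hence of [D]. *)
Lemma real_jordan_form_dot_le (R : realType) (d : nat) (D : 'M[R]_d) (m : R) :
  real_jordan_form D ->
  (forall z : R[i], eigenvalue (complexify D) z -> complex.Re z <= m) ->
  forall y : 'cV[R]_d, (y^T *m (D *m y)) ord0 ord0 <= m * enorm y ^+ 2.
Proof.
case=> n [p [B [eq_d [jB ->]]]]; subst d; rewrite castmx_id => Dm y.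
rewrite sqr_enorm_dot -(submxcolK y) mul_mxdiag_mxcol tr_mxcol.
rewrite !mul_mxrow_mxcol !summxE mulr_sumr; apply: ler_sum => i _.
have [z [u [u0 uB qB]]] := real_jordan_block_eigen (jB i).
rewrite mulmxA qB -sqr_enorm_dot ler_wpM2r ?sqr_ge0//; apply: Dm.
have -> : complexify (mxdiag B) = mxdiag (fun i => complexify (B i)).
  apply/matrixP => a b; rewrite !mxE.
  case: (tagnat.sig1 a =P _) (tagnat.sig2 b) => [<-|_] b'.
    by rewrite !conform_mx_id !mxE.
  by rewrite !mxE rmorph0.
exact: eigenvalue_mxdiag u0 uB.
Qed.

(** In the coordinates [invmx Q *m x] the matrix [A] acts as [D]. By similarity a left eigenvector v
    of [D] gives the left eigenvector v Q^-1 of [A], so the bound [m] carries over to the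
    eigenvalues of [D]. *)
Lemma eigenvector_matrix_dot_le (R : realType) (d : nat) (A Q : 'M[R]_d)
    (m : R) :
  eigenvector_matrix A Q ->
  (forall z : R[i], eigenvalue (complexify A) z -> complex.Re z <= m) ->
  forall x : 'cV[R]_d,
    ((invmx Q *m x)^T *m (invmx Q *m (A *m x))) ord0 ord0
      <= m * enorm (invmx Q *m x) ^+ 2.
Proof.
move=> [Qu [D jD defA]] Am x.
have -> : invmx Q *m (A *m x) = D *m (invmx Q *m x).
  by rewrite defA !mulmxA mulVmx// mul1mx.
apply: (real_jordan_form_dot_le jD) => z /eigenvalueP[v vD v0]; apply: Am.
have QK : complexify Q *m complexify (invmx Q) = 1%:M.
  by rewrite /complexify -map_mxM mulmxV// map_mx1.
have KQ : complexify (invmx Q) *m complexify Q = 1%:M.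
  by rewrite /complexify -map_mxM mulVmx// map_mx1.
apply/eigenvalueP; exists (v *m complexify (invmx Q)).
  rewrite defA /complexify !map_mxM -/(complexify _) -/(complexify Q).
  rewrite !mulmxA -(mulmxA v) KQ mulmx1 vD scalemxAl//.
by apply: contra v0 => /eqP e; rewrite -[v]mulmx1 -KQ mulmxA e mul0mx.
Qed.

(** * Derivatives of vector functions and growth within one mode *)

Lemma is_derive_colP (R : realType) (d : nat) (x : R -> 'cV[R]_d)
    (v : 'cV[R]_d) (s : R) :
  is_derive s 1 x v <->
  forall i, is_derive s 1 (fun u => x u i ord0) (v i ord0).
Proof.
split=> [[xs <-] i|H].
  split; first exact: ((derivable_mxP _ _ _).1 xs).
  by rewrite derive_mx// mxE.
have xs : derivable x s 1.
  by apply/derivable_mxP => i j; rewrite (ord1 j); have [] := H i.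
split=> //; rewrite derive_mx//; apply/colP => i; rewrite mxE.
by have [_ ->] := H i.
Qed.

Lemma is_derive_mulmx (R : realType) (d : nat) (P : 'M[R]_d)
    (x : R -> 'cV[R]_d) (v : 'cV[R]_d) (s : R) :
  is_derive s 1 x v -> is_derive s 1 (fun u => P *m x u) (P *m v).
Proof.
move=> /is_derive_colP xv; apply/is_derive_colP => i.
rewrite (_ : (fun u => _) = \sum_j (P i j \*: (fun u => x u j ord0))).
  rewrite mxE; apply: is_derive_sum.
by apply/funext => u; rewrite mxE fct_sumE.
Qed.

Lemma within_continuous_sum (R : realType) (d : nat) (f : 'I_d -> R -> R)
    (S : set R) :
  (forall i, {within S, continuous (f i)}) ->
  {within S, continuous (fun s => \sum_i f i s)}.
Proof.
move=> cf; apply: continuous_big => [|i _]; first exact: add_continuous.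
exact: cf.
Qed.

(** The argument runs on the squared norm, whose derivative is twice the dot product of [w] and
    [dw]; the norm itself may fail to be differentiable where [w] vanishes. *)
Lemma enorm_nincr (R : realType) (d : nat) (w dw : R -> 'cV[R]_d) (a b : R) :
  (forall i, {within `[a, b], continuous (fun s => w s i ord0)}) ->
  (forall s, a < s < b -> is_derive s 1 w (dw s)) ->
  (forall s, a < s < b -> ((w s)^T *m dw s) ord0 ord0 <= 0) ->
  forall s, a <= s <= b -> enorm (w s) <= enorm (w a).
Proof.
move=> cw wdw wle0 s /andP[as_ sb].
pose f u := enorm (w u) ^+ 2.
have fdf u : a < u < b -> is_derive u 1 f (2 * ((w u)^T *m dw u) ord0 ord0).
  move=> uab; have /is_derive_colP wi := wdw u uab.
  rewrite (_ : f = \sum_i (fun u => w u i ord0) ^+ 2); last first.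
    by apply/funext => v; rewrite /f sqr_enorm fct_sumE.
  apply: is_derive_eq; rewrite mxE mulr_sumr; apply: eq_bigr => i _.
  by rewrite mxE expr1 mulrA -mulr_natl.
suff : f s <= f a.
  by rewrite ler_sqr// nnegrE enorm_ge0.
apply: (@ler0_derive1_nincr _ f a b) => //.
- by move=> u; rewrite in_itv/= => /fdf[].
- move=> u; rewrite in_itv/= => uab; have [_] := fdf u uab.
  by rewrite derive1E => ->; rewrite pmulr_rle0// wle0.
- rewrite (_ : f = (fun u => \sum_i w u i ord0 * w u i ord0)); last first.
    by apply/funext => v; rewrite /f sqr_enorm; under eq_bigr do rewrite expr2.
  by apply: within_continuous_sum => i u; apply: cvgM; exact: cw.
Qed.

Lemma enorm_mode_le (R : realType) (d : nat) (A Q : 'M[R]_d) (m : R)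
    (x : R -> 'cV[R]_d) (a b : R) :
  eigenvector_matrix A Q ->
  (forall z : R[i], eigenvalue (complexify A) z -> complex.Re z <= m) ->
  {within `[a, b], continuous x} ->
  (forall s, a < s < b -> is_derive s 1 x (A *m x s)) ->
  forall s, a <= s <= b ->
    enorm (invmx Q *m x s) <= expR (m * (s - a)) * enorm (invmx Q *m x a).
Proof.
move=> AQ Am cx dx s sab; set P := invmx Q.
(* By the product rule [dw] is the derivative of [w] when x' = A x. The exponential weight subtracts
   [m] times the squared norm from the quadratic form, so the dot product of [w] and [dw] is at most
   0. *)
pose w u := expR (- (m * u)) *: (P *m x u).
pose dw u := expR (- (m * u)) *: (P *m (A *m x u) - m *: (P *m x u)).
suff : enorm (w s) <= enorm (w a).
  rewrite !enormZ !ger0_norm ?expR_ge0// mulrBr expRD -mulrA => h.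
  by rewrite -ler_pdivrMl ?expR_gt0// -expRN.
apply: (@enorm_nincr _ _ w dw a b) => //.
- move=> i.
  rewrite (_ : (fun u => _) =
    (fun u => expR (- (m * u)) * \sum_j P i j * x u j ord0)); last first.
    by apply/funext => u; rewrite !mxE.
  move=> u; apply: cvgM.
    apply: continuous_subspaceT u => u.
    apply: (@continuous_comp _ _ _ (fun u => - (m * u)) expR).
      by apply: cvgN; apply: cvgM; [exact: cvg_cst|exact: cvg_id].
    exact: continuous_expR.
  apply: within_continuous_sum u => j u; apply: cvgM; first exact: cvg_cst.
  apply: (@within_continuous_comp _ _ _ _ x (fun M => M j ord0)) => // M _.
  exact: coord_continuous.
- move=> u uab; apply/is_derive_colP => i.
  have /is_derive_colP/(_ i) H := is_derive_mulmx P (dx u uab).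
  rewrite (_ : (fun v => _) =
    (fun v => expR (- (m * v))) * (fun v => (P *m x v) i ord0)); last first.
    by apply/funext => v; rewrite mxE.
  have E : is_derive u 1 (fun v => expR (- (m * v))) (- m * expR (- (m * u))).
    rewrite (_ : (fun v => _) = expR \o (- m \*: id)); last first.
      by apply/funext => v; rewrite /= /GRing.scale/= mulNr.
    apply: is_derive_eq.
    rewrite /GRing.scale/= mulr1 mulrC; congr (_ * expR _); exact: mulNr.
  apply: is_derive_eq; rewrite /dw /GRing.scale/=.
  move: (P *m (A *m x u)) (P *m x u) => X Y; rewrite !mxE.
  by ring.
- move=> u uab; have := eigenvector_matrix_dot_le AQ Am (x u).
  rewrite sqr_enorm_dot /w /dw -scalemxAr.
  rewrite [X in X *m (_ - _)]linearZ/= -scalemxAl scalerA.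
  rewrite mulmxBr -scalemxAr -/P.
  move: (_ *m (P *m (A *m x u))) (_ *m (P *m x u)) => X Y XY.
  by rewrite !mxE pmulr_rle0 ?mulr_gt0 ?expR_gt0// subr_le0.
Qed.

(** * Maxima over edges and limits along the switching intervals *)

Lemma edge_max_ge (R : realType) (k : nat) (E : rel 'I_k)
    (f : 'I_k -> 'I_k -> R) (i j : 'I_k) :
  E i j -> ((f i j)%:E <= edge_max E f)%E.
Proof.
move=> Eij; rewrite /edge_max.
exact: (le_bigmax_cond _ (fun e => (f e.1 e.2)%:E) (j := (i, j))).
Qed.

(* For [N <= 0] the hypothesis is about the junk value [ln N = 0]. *)
Lemma lt_expR_ln (R : realType) (N y : R) : ln N < y -> N < expR y.
Proof.
move=> lnN; have [N0|N0] := ltP 0 N; first by rewrite -(lnK N0) ltr_expR.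
exact: le_lt_trans N0 (expR_gt0 y).
Qed.

Lemma mem_interval_cvgy (R : realType) (t : nat -> R) (N : nat) (s : R) :
  t n @[n --> \oo] --> +oo -> t N <= s ->
  exists2 n, (N <= n)%N & t n <= s < t n.+1.
Proof.
move=> toy Ns.
have [n0 _ n0P] : \forall n \near \oo, s < t n by exact: (cvgryPgt _).1 toy s.
have exn : exists n, s < t (N + n)%N.
  by exists n0; apply: n0P => /=; rewrite leq_addl.
(* The least index with [s] before its switching time closes the interval containing [s]; it is not
   [N] itself because [t N <= s]. *)
case: (ex_minnP exn) => -[|n] sn nmin; first by move: sn; rewrite addn0 ltNge Ns.
exists (N + n)%N; first exact: leq_addr.
rewrite -addnS sn andbT leNgt; apply/negP => /nmin.
by rewrite ltnn.
Qed.

Lemma cvgy0_geometric_interval (R : realType) (t : nat -> R) (f : R -> R)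
    (rho C : R) :
  t n @[n --> \oo] --> +oo -> 0 <= rho < 1 -> (forall s, 0 <= f s) ->
  (forall n s, t n <= s < t n.+1 -> f s <= C * rho ^+ n) ->
  f s @[s --> +oo] --> (0 : R).
Proof.
move=> toy /andP[rho0 rho1] f0 fle; apply/cvgr0Pnorm_lt => e e0.
have /cvgr0_norm_lt/(_ _ e0)[N _ NP] : geometric C rho @ \oo --> (0 : R).
  by apply: cvg_geometric; rewrite ger0_norm.
near=> s; have [||n Nn ns] := @mem_interval_cvgy _ t N s => //.
rewrite ger0_norm//; apply: le_lt_trans (fle n s ns) _.
exact: le_lt_trans (ler_norm _) (NP n Nn).
Unshelve. all: by end_near. Qed.

(** * Contraction from one switching time to the next *)

Theorem proposition4p16 (R : realType) (d k r : nat) (E : rel 'I_k)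
    (A Q : 'I_k -> 'M[R]_d) (lambda mu : 'I_k -> R) (tau eta : R)
    (sigma : R -> 'I_k) (t : nat -> R)
    (hr : (1 <= r)%N) (hrk : (r < k)%N)
    (hloop : has_loop E)
    (hus : forall i : 'I_k, (r <= i)%N ->
       exists2 j : 'I_k, (j < r)%N & connect E i j)
    (hsu : forall i : 'I_k, (i < r)%N ->
       exists2 j : 'I_k, (r <= j)%N & connect E i j)
    (hdiag : forall i, diagonalizable (complexify (A i)))
    (hstable : forall i : 'I_k, (i < r)%N -> stable (A i))
    (hunstable : forall i : 'I_k, (r <= i)%N -> unstable (A i))
    (hlambda : forall i : 'I_k, (i < r)%N ->
       max_real_part (A i) (- lambda i) /\ - lambda i < 0)
    (hmu : forall i : 'I_k, (r <= i)%N ->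
       max_real_part (A i) (mu i) /\ 0 < mu i)
    (hacyclic : ~ has_loop (Gu r E))
    (hQ : forall i, eigenvector_matrix (A i) (Q i))
    (hQmax : (edge_max (Gu r E) (fun a b => snorm (invmx (Q b) *m Q a)) < 1%:E)%E)
    (htau : 0 < tau) (heta : 0 < eta)
    (hsigma : switching_signal sigma t)
    (hadm : admissible E sigma t)
    (hrec : forall T : R, 0 < T ->
       (exists2 u : R, T < u & (sigma u < r)%N) /\
       (exists2 s : R, T < s & (r <= sigma s)%N))
    (hS : dwell_flee r sigma t tau eta)
    (htau_max : (edge_max (Gs r E)
       (fun i j => ln (snorm (invmx (Q j) *m Q i)) / lambda i)%R < tau%:E)%E)
    (heta_max : (eta%:E < - edge_max (Gu r E)
       (fun i j => ln (snorm (invmx (Q j) *m Q i)) / mu i)%R)%E) :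
  asymptotically_stable A sigma t.
Proof.
case: hsigma => t0 tS toy sigmaE _ x0 x [cx dx] _.
(* [m] and [T] treat both kinds of modes at once: a negative rate with duration at least [T], or a
   positive rate with duration at most [T], gives rate times duration at most [m i * T i]. *)
pose m (i : 'I_k) := if (i < r)%N then - lambda i else mu i.
pose T (i : 'I_k) := if (i < r)%N then tau else eta.
pose N i j := snorm (invmx (Q j) *m Q i).
pose w n := enorm (invmx (Q (sigma (t n))) *m x (t n)).
have Am i z : eigenvalue (complexify (A i)) z -> complex.Re z <= m i.
  rewrite /m; case: ltnP => [/hlambda|/hmu] [[_ h] _]; exact: h.
have m_st (i : 'I_k) : (i < r)%N -> m i < 0.
  by move=> ir; rewrite /m ir; case: (hlambda i ir).
have m_un (i : 'I_k) : (r <= i)%N -> 0 < m i.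
  by move=> ir; rewrite /m ltnNge ir; case: (hmu i ir).
have tge0 n : 0 <= t n.
  by elim: n => [|n IHn]; [rewrite t0|exact: le_trans IHn (ltW (tS n))].
(* The right end is included although [sigma] has already switched there: the estimate uses the
   equation on the open interval and only continuity of [x] on the closed one. *)
have mode n s : t n <= s <= t n.+1 ->
    enorm (invmx (Q (sigma (t n))) *m x s) <=
    expR (m (sigma (t n)) * (s - t n)) * w n.
  move=> sn; apply: (enorm_mode_le (b := t n.+1) (hQ _) (Am _)) => //.
    apply: continuous_subspaceW cx => u /=; rewrite !in_itv/= andbT => /andP[+ _].
    exact: le_trans.
  move=> u un; rewrite -(sigmaE n u); last by case/andP: un => /ltW -> ->.
  exact: (dx n).
(* In logarithms the claim is ln N < - m T, which is the assumed bound on [tau] when m = - lambda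
   and the one on [eta] when m = mu. *)
have contr i j : E i j -> N i j * expR (m i * T i) < 1.
  move=> Eij; rewrite -ltr_pdivlMr ?expR_gt0// mul1r -expRN; apply: lt_expR_ln.
  rewrite /m /T; case: (ltnP i r) => ir.
    rewrite mulNr opprK mulrC -ltr_pdivrMr; last first.
      by rewrite -oppr_lt0; case: (hlambda i ir).
    rewrite -lte_fin; apply: le_lt_trans htau_max.
    by apply: (edge_max_ge (fun i j => ln (N i j) / lambda i)); rewrite /Gs Eij.
  rewrite ltrNr mulrC -ltr_pdivlMr; last by case: (hmu i ir).
  rewrite mulNr -lte_fin; apply: lt_le_trans heta_max _.
  rewrite EFinN leeN2.
  by apply: (edge_max_ge (fun i j => ln (N i j) / mu i)); rewrite /Gu Eij.
(* A maximum over finitely many edges, each below 1, stays below 1; the initial value 0 makes [rho]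
   nonnegative. *)
pose rho := \big[Num.max/0]_(e : 'I_k * 'I_k | E e.1 e.2)
  (N e.1 e.2 * expR (m e.1 * T e.1)).
have rho0 : 0 <= rho by exact: bigmax_ge_id.
have rho1 : rho < 1 by apply: bigmax_lt => // e; exact: contr.
have wS n : w n.+1 <= rho * w n.
  set i := sigma (t n); set j := sigma (t n.+1).
  (* [Q i *m invmx (Q i)] is inserted to pass from the coordinates of the old mode to those of the
     new one. *)
  have -> : w n.+1 = enorm (invmx (Q j) *m Q i *m (invmx (Q i) *m x (t n.+1))).
    by rewrite mulmxA mulmxK//; case: (hQ i).
  apply: le_trans (enorm_mulmx_le _ _) _.
  have tn : t n <= t n.+1 <= t n.+1 by rewrite lexx ltW.
  apply: le_trans (ler_wpM2l (snorm_ge0 _) (mode n _ tn)) _.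
  rewrite mulrA ler_wpM2r ?enorm_ge0//.
  apply: (@le_trans _ _ (N i j * expR (m i * T i))); last first.
    exact: (le_bigmax_cond _ (fun e => N e.1 e.2 * expR (m e.1 * T e.1))
      (j := (i, j)) (hadm n)).
  rewrite ler_wpM2l ?snorm_ge0// ler_expR /T -/i.
  have [hst hun] := hS n; case: ltnP => ir.
    by rewrite ler_nM2l ?m_st// hst.
  by rewrite ler_pM2l ?m_un// hun.
have wle n : w n <= rho ^+ n * w 0%N.
  elim: n => [|n IHn]; first by rewrite expr0 mul1r.
  by rewrite exprS -mulrA; apply: le_trans (wS n) _; rewrite ler_wpM2l.
(* [K] bounds the growth at any point of a switching interval: none in a stable mode, at most exp
   (mu eta) in an unstable one. The sum over all modes in [C] dominates each of its nonnegative
   terms, which gives one constant for every [n]. *)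
pose K (i : 'I_k) := expR (if (i < r)%N then 0 else m i * eta).
pose C := (\sum_i snorm (Q i) * K i) * w 0%N.
apply: (@cvgy0_geometric_interval _ t (fun s => enorm (x s)) rho C) => //.
- by rewrite rho0.
- by move=> s; exact: enorm_ge0.
move=> n s /andP[ns sn]; set i := sigma (t n).
have -> : x s = Q i *m (invmx (Q i) *m x s).
  by rewrite mulmxA mulmxV ?mul1mx//; case: (hQ i).
apply: le_trans (enorm_mulmx_le _ _) _.
have QK0 j : 0 <= snorm (Q j) * K j by rewrite mulr_ge0 ?snorm_ge0 ?expR_ge0.
apply: (@le_trans _ _ (snorm (Q i) * K i * w n)).
  rewrite -mulrA ler_wpM2l ?snorm_ge0//.
  apply: le_trans (mode n s _) _; first by rewrite ns ltW.
  rewrite ler_wpM2r ?enorm_ge0// ler_expR -/i.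
  have [_ hun] := hS n; case: ltnP => ir.
    by rewrite nmulr_rle0 ?m_st// subr_ge0.
  by rewrite ler_pM2l ?m_un// (le_trans _ (hun ir))// lerD2r ltW.
rewrite /C -[leRHS]mulrA [w 0%N * _]mulrC ler_pM ?enorm_ge0 ?wle//.
by rewrite (bigD1 i)//= lerDl sumr_ge0.
Qed.
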